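(* Let $H$ be a finite simple graph with $\Delta(H)\le 2$, and let $G$ be obtained from $H$ by gluing in vertex-disjoint copies of $K_4$, i.e. there are pairwise disjoint $4$-element subsets $Y_1,\dots,Y_q\subseteq V(H)$ and $G$ has vertex set $V(H)$ and edge set $E(H)\cup\{uv: u\neq v,\ u,v\in Y_j \text{ for some } j\}$. Let $\mathcal{T}$ be the set of triangles of $H$. Then there is a set of vertices $Z$ with $|Z|\le |\mathcal{T}|/4$, containing at most one vertex from each cycle of $H$, such that $\chi(G-Z)\le 4$. Moreover, $|V(G)\setminus Z|\ge \tfrac{11}{12}|V(G)|$.
   Context: All graphs are finite and simple; the cycles of $H$ are its cycle components. *)

(* Defs.v *)
From mathcomp Require Import all_boot.
Set Implicit Arguments. Unset Strict Implicit. Unset Printing Implicit Defensive.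

Section Graphs.
Variable T : finType.

Definition simple_graph (e : rel T) : Prop :=
  symmetric e /\ irreflexive e.

Definition nbhd (e : rel T) (x : T) : {set T} := [set y | e x y].
Definition deg (e : rel T) (x : T) : nat := #|nbhd e x|.

Definition max_deg_le (e : rel T) (k : nat) : Prop := forall x, deg e x <= k.

Definition component (e : rel T) (x : T) : {set T} := [set y | connect e x y].

(* a cycle of H = a connected component which is a cycle, i.e. (for a simple
   graph) a connected component all of whose vertices have degree 2 *)
Definition cycle_component (e : rel T) (C : {set T}) : Prop :=
  (exists x, C = component e x) /\ (forall y, y \in C -> deg e y = 2).

Definition triangles (e : rel T) : {set {set T}} :=
  [set S : {set T} | (#|S| == 3) &&
     [forall x in S, forall y in S, (x != y) ==> e x y]].

Definition glue (e : rel T) (q : nat) (Y : 'I_q -> {set T}) : rel T :=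
  fun u v => e u v || ((u != v) && [exists j, (u \in Y j) && (v \in Y j)]).

Definition colourable_minus (g : rel T) (Z : {set T}) (k : nat) : Prop :=
  exists f : T -> 'I_k, forall u v, u \notin Z -> v \notin Z -> g u v -> f u != f v.

End Graphs.

(* Main.v *)
Require Import Defs.
From mathcomp Require Import all_boot all_fingroup all_algebra all_field ring zify.

(** The fourth colour class is built around an independent transversal [t] of the
    sets [Y j], which exists by Haxell's theorem (4 = 2 * 2). If an H-cycle [C]
    inside the union of the [Y j] is missed by [t], replacing [t j] by a vertex
    [u] of [C] in [Y j] hits [C]; when the number of missed cycles is minimal,
    [t j] was then the only hit on another such cycle, which is now the missed
    one. Let R be the set of cycles missed at some point of such a sequence of
    swaps, and m the minimum. Each cycle of R is hit at most once, so the
    representatives of the classes meeting R number at most |R| - m, and the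
    cycles of R have at most 4 (|R| - m) vertices in total: at least 4 m of them
    are triangles. Delete one vertex of each missed cycle.

    Missed cycles leaving the union of the [Y j] give up one uncovered vertex to
    the fourth class as well. What remains of H is a linear forest, and of each
    [Y j] a triangle; completing both to a Hamiltonian path x_0, ..., x_n and
    disjoint triangles, it is enough to 3-colour the triangles and the path
    together. Colours are cube roots of unity in the field with four elements,
    and the sum over all colourings of the triangles of
    (1 + x_n) x_0 prod (x_i + x_(i+1)) is shown to be 1, so some term does not
    vanish. Expanding into monomials, the sum counts modulo 2 the choices of one
    vertex z_j in each triangle such that, on the path without the z_j, the two
    other vertices of each triangle have positions of different parities. *)

Set Implicit Arguments.
Unset Strict Implicit.
Unset Printing Implicit Defensive.

Import GRing.Theory.

Definition upd (I : finType) (A : Type) (z : {ffun I -> A}) (k : I) (a : A) :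
  {ffun I -> A} := [ffun i => if i == k then a else z i].

(** * Sums in characteristic 2 *)

Section Char2Sums.
Local Open Scope ring_scope.

Variable R : comNzRingType.
Hypothesis char2 : 2 \in [pchar R].

Lemma natr_odd (n : nat) : n%:R = (odd n)%:R :> R.
Proof.
rewrite -[in LHS](odd_double_half n) natrD -addnn natrD.
by rewrite (addrr_pchar2 char2) addr0.
Qed.

(** Equal terms of a two-element orbit cancel; comparing ranks selects one element of each such
    orbit. *)
Lemma sum_involution_fixed (I : finType) (inv : I -> I) (g : I -> R) :
  involutive inv -> (forall i, g (inv i) = g i) ->
  \sum_i g i = \sum_(i | inv i == i) g i.
Proof.
move=> invK g_inv; rewrite (bigID (fun i => inv i == i)) /=.
set rest := \sum_(i | _ != _) _; suff -> : rest = 0 by rewrite addr0.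
rewrite /rest (bigID (fun i => enum_rank (inv i) < enum_rank i)%N) /=.
rewrite [X in _ + X](reindex_inj (inv_inj invK)) /=.
rewrite [X in _ + X = _](eq_big (fun i => (inv i != i) && (enum_rank (inv i) < enum_rank i)%N) g).
- by rewrite (addrr_pchar2 char2).
- move=> i; rewrite invK eq_sym -leqNgt leq_eqVlt.
  by case: eqVneq => //= nii; rewrite (inj_eq val_inj) (inj_eq enum_rank_inj) (negPf nii).
- by move=> i _.
Qed.

(* Three is odd, so the sum equals the sum over the three shifts of the
   coordinate at [k]. *)
Lemma sum_coordinate0 (I : finType) (k : I) (g : {ffun I -> 'I_3} -> R) :
  (forall z, \sum_a g (upd z k a) = 0) -> \sum_z g z = 0.
Proof.
move=> g0.
have shift (a : 'I_3) : \sum_z g z = \sum_z g (upd z k (z k + a)).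
  apply: reindex_inj; apply: (can_inj (g := fun z => upd z k (z k - a))) => z.
  by apply/ffunP=> i; rewrite !ffunE eqxx addrK; case: eqP => // ->.
have <- : \sum_(a : 'I_3) \sum_z g z = \sum_z g z.
  by rewrite sumr_const card_ord [_ *+ 3]mulrS mulr2n (addrr_pchar2 char2) addr0.
rewrite (eq_bigr _ (fun a _ => shift a)) exchange_big big1 // => z _ /=.
rewrite -[RHS](g0 z) [RHS](reindex_inj (addrI (z k))) /=.
by apply: eq_bigr.
Qed.

End Char2Sums.

(** * The path polynomial *)

Section Expansion.
Local Open Scope ring_scope.

Definition rank_off n (f : {ffun 'I_n -> bool}) (p : nat) : nat :=
  (\sum_(k < n | (k < p)%N) ~~ f k)%N.

(* Out-degrees along a path, oriented and with a loop at vertex 0: they differ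
   from 1 only off [f], where 2 and 0 alternate, starting with 2. *)
Definition outdeg n (f : {ffun 'I_n -> bool}) (i : 'I_n) : nat :=
  if f i then 1%N else if odd (rank_off f i) then 0%N else 2%N.

Definition ext n (f : {ffun 'I_n -> bool}) (b : bool) : {ffun 'I_n.+1 -> bool} :=
  [ffun i => if unlift ord_max i is Some j then f j else b].

Lemma widen_lift n (i : 'I_n) : widen_ord (leqnSn n) i = lift ord_max i.
Proof. by apply: val_inj; rewrite /= /bump leqNgt ltn_ord. Qed.

Lemma ext_lift n f b (i : 'I_n) : @ext n f b (lift ord_max i) = f i.
Proof. by rewrite ffunE liftK. Qed.

Lemma ext_max n f b : @ext n f b ord_max = b.
Proof. by rewrite ffunE unlift_none. Qed.

Lemma rank_off_ext n f b (p : nat) : (p <= n)%N -> rank_off (@ext n f b) p = rank_off f p.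
Proof.
move=> le_pn; rewrite /rank_off big_mkcond big_ord_recr /= ltnNge le_pn addn0.
by rewrite [RHS]big_mkcond; apply: eq_bigr => i _ /=; rewrite widen_lift ext_lift.
Qed.

Lemma rank_off_extS n f b : rank_off (@ext n f b) n.+1 = (rank_off f n + ~~ b)%N.
Proof.
rewrite /rank_off big_mkcond big_ord_recr /= ltnSn ext_max; congr addn.
rewrite [RHS]big_mkcond; apply: eq_bigr => i _ /=.
by rewrite widen_lift ext_lift ltn_ord ltnS ltnW.
Qed.

Lemma outdeg_ext n f b (i : 'I_n) : outdeg (ext f b) (lift ord_max i) = outdeg f i.
Proof. by rewrite /outdeg ext_lift lift_max rank_off_ext // ltnW. Qed.

Lemma outdeg_ext_max n f b :
  outdeg (@ext n f b) ord_max = if b then 1%N else if odd (rank_off f n) then 0%N else 2%N.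
Proof. by rewrite /outdeg ext_max rank_off_ext. Qed.

Variable R : comNzRingType.

Lemma sum_ext n (P : pred {ffun 'I_n.+1 -> bool}) (g : {ffun 'I_n.+1 -> bool} -> R) :
  \sum_(f | P f) g f = \sum_(b : bool) \sum_(f | P (ext f b)) g (ext f b).
Proof.
rewrite (reindex (fun p : bool * {ffun 'I_n -> bool} => ext p.2 p.1)) /=.
  by rewrite pair_big_dep.
exists (fun f => (f ord_max, [ffun i => f (lift ord_max i)])) => [[b f] _ | f _] /=.
  by rewrite ext_max; congr pair; apply/ffunP=> i; rewrite ffunE ext_lift.
by apply/ffunP=> i; rewrite ffunE; case: unliftP => [j|] -> //; rewrite ffunE.
Qed.

Variable x : nat -> R.

(** The parity of the number of exponents other than 1 decides whether the next such exponent is 2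
    or 0; splitting by it gives a closed recurrence. *)
Definition monomials n (c : bool) : R :=
  \sum_(f : {ffun 'I_n -> bool} | odd (rank_off f n) == c) \prod_(i < n) x i ^+ outdeg f i.

Lemma monomialsS n c :
  monomials n.+1 c = x n * monomials n c + (if c then x n ^+ 2 else 1) * monomials n (~~ c).
Proof.
rewrite /monomials sum_ext big_bool /=; congr (_ + _); rewrite big_distrr /=.
- apply: eq_big => f; first by rewrite rank_off_extS addn0.
  move=> _; rewrite big_ord_recr /= outdeg_ext_max expr1 mulrC; congr (_ * _).
  by apply: eq_bigr => i _; rewrite widen_lift outdeg_ext.
- apply: eq_big => f; first by rewrite rank_off_extS addn1 /=; case: odd; case: c.
  rewrite rank_off_extS addn1 /= => par.
  rewrite big_ord_recr /= outdeg_ext_max mulrC; congr (_ * _); last first.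
    by apply: eq_bigr => i _; rewrite widen_lift outdeg_ext.
  by case: odd par; case: c.
Qed.

(** In the even part every edge picks an endpoint and the loop at 0 picks [x 0]; the odd part
    carries one more loop, at the last vertex. Both follow together from the recurrence. *)
Lemma monomials_path n :
  monomials n.+1 false = x 0%N * \prod_(i < n) (x i + x i.+1) /\
  monomials n.+1 true = x n * (x 0%N * \prod_(i < n) (x i + x i.+1)).
Proof.
elim: n => [|n [IH0 IH1]].
  have m0 c : monomials 0 c = (~~ c)%:R.
    rewrite /monomials; case: c => /=; last first.
      rewrite (eq_bigl xpredT) => [|f]; last by rewrite /rank_off big_ord0.
      rewrite (eq_bigr (fun=> 1)) => [|f _]; last by rewrite big_ord0.
      by rewrite sumr_const card_ffun card_bool card_ord.
    by rewrite big_pred0 // => f; rewrite /rank_off big_ord0.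
  by rewrite !monomialsS !m0 /= !big_ord0; split; ring.
rewrite !(monomialsS n.+1) /= IH0 IH1 !big_ord_recr /=; split; first by ring.
by rewrite -[x n.+1 ^+ 2]/(x n.+1 * x n.+1); ring.
Qed.

(** The factor [1 + x n] adds up the two parity classes, so that [f] ranges over all functions
    without restriction. *)
Lemma path_expansion n :
  \sum_(f : {ffun 'I_n.+1 -> bool}) \prod_(i < n.+1) x i ^+ outdeg f i =
  (1 + x n) * x 0%N * \prod_(i < n) (x i + x i.+1).
Proof.
rewrite (bigID (fun f => odd (rank_off f n.+1) == false)) /=.
rewrite -/(monomials n.+1 false) [X in _ + X](_ : _ = monomials n.+1 true).
  by have [-> ->] := monomials_path n; ring.
by apply: eq_bigl => f; case: odd.
Qed.

End Expansion.

(** * Vandermonde sums at a cube root of unity *)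

Section Vandermonde3.
Local Open Scope ring_scope.

Variable R : comNzRingType.
Hypothesis char2 : 2 \in [pchar R].
Variable w : R.
Hypothesis w_root : w ^+ 2 = w + 1.

Lemma cube_root : w ^+ 3 = 1.
Proof.
rewrite exprS w_root mulrDr mulr1 -expr2 w_root -addrA addrC -addrA.
by rewrite (addrr_pchar2 char2) addr0.
Qed.

(** Signs vanish in characteristic 2, leaving a Vandermonde determinant in the [w ^+ e i]. A
    repeated exponent makes a factor zero; the exponents 0, 1, 2 have differences [w + 1], [w] and
    1, whose product is 1. *)
Lemma vandermonde3 (e : 'I_3 -> nat) : (forall i, e i <= 2)%N ->
  \sum_(s : 'S_3) \prod_i w ^+ (e i * s i) = (injectiveb e)%:R.
Proof.
move=> e_le; pose A := Vandermonde 3 (\row_i w ^+ e i).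
have -> : \sum_(s : 'S_3) \prod_i w ^+ (e i * s i) = \det A.
  rewrite -det_tr; apply: eq_bigr => s _; rewrite (oppr_pchar2 char2) expr1n mul1r.
  by apply: eq_bigr => i _; rewrite !mxE exprM.
have sum1 : w + 1 + 1 = w by rewrite -addrA (addrr_pchar2 char2) addr0.
have sumw : w + (w + 1) = 1 by rewrite addrA (addrr_pchar2 char2) add0r.
have wM : w * (w + 1) = 1 by rewrite -w_root -exprS cube_root.
rewrite /A det_Vandermonde.
under eq_bigr => i _ do rewrite big_mkcond.
rewrite /= !big_ord_recl !big_ord0 /= !mxE.
set e1 := e (lift ord0 ord0); set e0 := e ord0; set e2 := e (lift _ (lift _ _)).
have -> : injectiveb e = uniq [:: e0; e1; e2].
  have enum0 : enum 'I_0 = [::] by apply: size0nil; rewrite size_enum_ord.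
  by rewrite /injectiveb /dinjectiveb; do 3 rewrite enum_ordSl /=; rewrite enum0.
move: (e_le _ : e0 <= 2)%N (e_le _ : e1 <= 2)%N (e_le _ : e2 <= 2)%N.
rewrite !(GRing.subr_pchar2 char2) /= !inE.
move: e0 e1 e2 => [|[|[|//]]] [|[|[|//]]] [|[|[|//]]] _ _ _ /=; rewrite ?expr0 ?expr1 ?w_root.
all: rewrite ?(addrr_pchar2 char2) ?mul0r ?mulr0 ?(addrC 1) ?(addrC (w + 1) w) ?sum1 ?sumw
  ?mulr1 ?mul1r ?(mulrC (w + 1) w) ?wM ?mul0r ?mulr0 //.
Qed.

End Vandermonde3.

(** * Counting marked vertices modulo 2 *)

Lemma ord3_others (a : 'I_3) :
  [/\ a + 1 != a, a + 1 + 1 != a, a + 1 + 1 != a + 1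
    & forall i, [&& i != a, i != a + 1 & i != a + 1 + 1] = false]%R.
Proof. by case: a => [[|[|[|]]]] //= ?; split=> // -[[|[|[|]]]]. Qed.

Lemma sum_ord3_others (R : nmodType) (a : 'I_3) (g : 'I_3 -> R) :
  (\sum_(i | i != a) g i = g (a + 1) + g (a + 1 + 1))%R.
Proof.
have [n0 n1 n10 no_other] := ord3_others a.
rewrite (bigD1 (a + 1)%R) //= (bigD1 (a + 1 + 1)%R) /= ?n1 // big_pred0 ?addr0 // => i.
by rewrite -andbA no_other.
Qed.

Section CrossingSum.
Local Open Scope ring_scope.

Variables (R : comNzRingType) (J : finType) (N : nat) (pos : J * 'I_3 -> 'I_N).
Hypothesis char2 : 2 \in [pchar R].
Hypothesis pos_inj : injective pos.

(* Summed over [k], this counts the unmarked vertices before the two unmarked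
   vertices of [j]; the sum is 1 iff their ranks have different parities. *)
Definition cross (j k : J) (a b : 'I_3) : R :=
  \sum_(i | i != a) \sum_(y | y != b) (pos (k, y) < pos (j, i))%N%:R.

(** Taking only the values 0 and 1, [cross] is idempotent, which settles the 2-cycles in
    [route_swap]. *)
Lemma cross_bool j k a b : exists c : bool, cross j k a b = c%:R.
Proof.
rewrite /cross.
under eq_bigr => i _ do rewrite -natr_sum.
by rewrite -natr_sum (natr_odd char2); eexists.
Qed.

(** Each [g i] occurs twice, once for each [a] other than [i]. *)
Lemma sum_others (g : 'I_3 -> R) : \sum_a \sum_(i | i != a) g i = 0.
Proof.
rewrite (exchange_big_dep xpredT) //= big1 // => i _.
rewrite sumr_const (eq_card (B := predC1 i)) => [|a]; last by rewrite !inE eq_sym.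
by rewrite cardC1 card_ord mulr2n (addrr_pchar2 char2).
Qed.

Lemma sum_cross_l j k b : \sum_a cross j k a b = 0.
Proof. exact: sum_others. Qed.

(** Each of the four pairs of unmarked vertices is counted on exactly one side, and four is even. *)
Lemma cross_sym j k a b : j != k -> cross j k a b = cross k j b a.
Proof.
move=> njk; apply/eqP; rewrite -subr_eq0 (GRing.subr_pchar2 char2) /cross.
rewrite [X in _ + X]exchange_big -big_split /=.
have two (c : 'I_3) (u : R) : \sum_(i | i != c) u = 0.
  by rewrite sumr_const cardC1 card_ord mulr2n (addrr_pchar2 char2).
rewrite big1 // => i _; rewrite -big_split -[RHS](two b 1) /=; apply: eq_bigr => y _.
have : pos (k, y) != pos (j, i) by rewrite (inj_eq pos_inj) xpair_eqE eq_sym (negPf njk).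
by rewrite -(inj_eq val_inj) /= => /negPf npos; case: ltngtP npos => // _ _; rewrite ?addr0 ?add0r.
Qed.

Lemma cross_diag j a : cross j j a a = 1.
Proof.
rewrite /cross !sum_ord3_others !ltnn addr0 add0r.
have : pos (j, a + 1) != pos (j, a + 1 + 1).
  have [_ _ n10 _] := ord3_others a.
  by rewrite (inj_eq pos_inj) xpair_eqE eqxx eq_sym.
by rewrite -(inj_eq val_inj) /= => /negPf npos; case: ltngtP npos => // _ _; rewrite ?addr0 ?add0r.
Qed.

(* The term of [p] when the product over [j] of the sums over [k] of crossings is
   expanded. Only [p = id] survives: a missed [k] or a 2-cycle gives 0, and the
   terms of [p] and [p^-1] cancel. *)
Definition route (p : J -> J) : R :=
  \sum_(z : {ffun J -> 'I_3}) \prod_j cross j (p j) (z j) (z (p j)).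

(** If [p] misses [k], the coordinate [z k] enters only the factor of [k], which sums to 0 over
    it. *)
Lemma route_missed p k : (forall j, p j != k) -> route p = 0.
Proof.
move=> missed; apply: (sum_coordinate0 char2 (k := k)) => z.
under eq_bigr => a _.
  rewrite (bigD1 k) //= !ffunE eqxx (negPf (missed k)).
  under eq_bigr => j njk do rewrite !ffunE (negPf njk) (negPf (missed j)).
  over.
by rewrite -big_distrl /= sum_cross_l mul0r.
Qed.

Lemma route_inv (p : {perm J}) : route p^-1%g = route p.
Proof.
apply: eq_bigr => z _; rewrite (reindex_inj (@perm_inj _ p)) /=.
apply: eq_bigr => j _; rewrite permK.
by have [<- // | nj] := eqVneq j (p j); apply: cross_sym; rewrite eq_sym.
Qed.

(** By symmetry the factors of [k] and [p k] coincide, and by idempotence their product is a single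
    one; it alone depends on [z k], and sums to 0. *)
Lemma route_swap p k : involutive p -> p k != k -> route p = 0.
Proof.
move=> pK npk; apply: (sum_coordinate0 char2 (k := k)) => z.
under eq_bigr => a _.
  rewrite (bigD1 k) //= (bigD1 (p k)) //= pK !ffunE eqxx (negPf npk) mulrA.
  rewrite (cross_sym _ _ npk) [X in X * _](_ : _ = cross k (p k) a (z (p k))); last first.
    by have [c ->] := cross_bool k (p k) a (z (p k)); case: c; rewrite ?mul0r ?mulr1.
  under eq_bigr => j /andP [njk njpk].
    rewrite !ffunE (negPf njk) (_ : p j == k = false); last first.
      by apply: contraNF njpk => /eqP <-; rewrite pK.
    over.
  over.
by rewrite -big_distrl /= sum_cross_l mul0r.
Qed.

(** There are [3 ^ #|J|] terms, an odd number, each equal to 1. *)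
Lemma route_id : route id = 1.
Proof.
rewrite /route (eq_bigr (fun=> 1)) => [|z _]; last by rewrite big1 // => j _; exact: cross_diag.
rewrite sumr_const card_ffun card_ord (natr_odd char2) oddX.
by rewrite orbT.
Qed.

Lemma sum_cross : \sum_(z : {ffun J -> 'I_3}) \prod_j \sum_k cross j k (z j) (z k) = 1.
Proof.
under eq_bigr => z _ do rewrite bigA_distr_bigA.
rewrite exchange_big /=.
rewrite (bigID (fun p : {ffun J -> J} => injectiveb p)) /= [X in _ + X]big1 => [|p]; last first.
  (* A self-map of a finite set that is not injective misses some [k]. *)
  move=> /negP ninj; have [onto | /forallPn [k]] := boolP [forall k, k \in codom p].
    have /image_injP p_inj : #|image p J| == #|J|.
      by apply/eqP/eq_card => k; rewrite (forallP onto k).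
    by case: ninj; apply/injectiveP => x y; apply: p_inj.
  by move=> /codomP missed; apply: route_missed (k) _ => j; apply/eqP => pj; case: missed; exists j.
rewrite addr0 (reindex (@pval _)) /=; last first.
  pose to_perm := insubd (1%g : {perm J}).
  by exists to_perm => /= f injf; [apply: val_inj | ]; apply: insubdK.
transitivity (\sum_(s : {perm J}) route s).
  by apply: eq_big => [s | s _]; [rewrite (valP s) | apply: eq_bigr => z _; rewrite pvalE].
(* Only self-inverse permutations are left; apart from the identity, each moves some [k]. *)
rewrite (sum_involution_fixed char2 (@invgK _)) => [|s]; last exact: route_inv.
rewrite (bigD1 1%g) /=; last by rewrite invg1.
rewrite big1 ?addr0 => [|s /andP [/eqP sV ns1]].
  by rewrite -route_id; apply: eq_bigr => z _; apply: eq_bigr => j _; rewrite perm1.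
have [fix_s | /forallPn [k nk]] := boolP [forall k, s k == k].
  by case/eqP: ns1; apply/permP=> k; rewrite perm1 (eqP (forallP fix_s k)).
by apply: (route_swap (k := k)) => // j; rewrite -{1}sV permK.
Qed.

End CrossingSum.

(** * Colouring a path plus triangles *)

Section PathTriangles.
Local Open Scope ring_scope.

Variables (R : comNzRingType) (w : R).
Hypothesis char2 : 2 \in [pchar R].
Hypothesis w_root : w ^+ 2 = w + 1.
Variables (J : finType) (n : nat) (pos : J * 'I_3 -> 'I_n.+1) (at_pos : 'I_n.+1 -> J * 'I_3).
Hypothesis posK : cancel pos at_pos.
Hypothesis at_posK : cancel at_pos pos.

Let pos_inj : injective pos := can_inj posK.

Lemma outdeg_le2 m (f : {ffun 'I_m -> bool}) p : (outdeg f p <= 2)%N.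
Proof. by rewrite /outdeg; case: ifP => // _; case: ifP. Qed.

Lemma outdeg_eq1 m (f : {ffun 'I_m -> bool}) p : (outdeg f p == 1)%N = f p.
Proof. by rewrite /outdeg; case: ifP => // _; case: ifP. Qed.

Lemma inj_le2_onto1 (e : 'I_3 -> nat) :
  (forall i, e i <= 2)%N -> injective e -> exists i, e i = 1%N.
Proof.
move=> e_le e_inj; pose e' i : 'I_3 := inord (e i).
have e'_inj : injective e'.
  by move=> i i' /(congr1 val); rewrite /= !inordK ?ltnS //; apply: e_inj.
have [g _ gK] := injF_bij e'_inj.
by exists (g 1); have /(congr1 val) := gK 1; rewrite /= inordK ?ltnS.
Qed.

Lemma injectiveb_ord3 (e : 'I_3 -> nat) (a : 'I_3) :
  e a = 1%N -> e (a + 1) != 1%N -> e (a + 1 + 1) != 1%N ->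
  injectiveb e = (e (a + 1) != e (a + 1 + 1)).
Proof.
move=> ea e0 e1; have [n0 n1 n10 no_other] := ord3_others a.
apply/injectiveP/idP => [e_inj | e01 x y].
  by apply: contra n10 => /eqP /e_inj <-.
have split i : [|| i == a, i == a + 1 | i == a + 1 + 1].
  by have := no_other i; rewrite -!negb_or => /negbFE.
move: (a + 1 + 1) (a + 1) e0 e1 e01 split => c b e0 e1 e01 split {n0 n1 n10 no_other}.
by have /or3P [] := split x => /eqP ->; have /or3P [] := split y => /eqP -> // eq_e; exfalso; lia.
Qed.

Definition mark (z : {ffun J -> 'I_3}) : {ffun 'I_n.+1 -> bool} :=
  [ffun p => (at_pos p).2 == z (at_pos p).1].

Lemma mark_pos z j i : mark z (pos (j, i)) = (i == z j).
Proof. by rewrite ffunE posK. Qed.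

Lemma rank_off_mark z (p : nat) :
  rank_off (mark z) p = (\sum_k \sum_(y | y != z k) (pos (k, y) < p))%N.
Proof.
rewrite /rank_off big_mkcond (reindex pos) /=; last by exists at_pos => i _.
rewrite (eq_bigr (fun u : J * 'I_3 => if u.2 != z u.1 then (pos (u.1, u.2) < p)%N : nat else 0%N)).
  rewrite -(pair_bigA _ (fun j i => if i != z j then (pos (j, i) < p)%N : nat else 0%N)) /=.
  by apply: eq_bigr => k _; rewrite -big_mkcond.
by move=> [k y] _; rewrite mark_pos /=; do 2 case: ifP.
Qed.

(** The two unmarked vertices of [j] have out-degree 0 or 2 by the parity of their ranks, so they
    differ iff the ranks have odd sum. Sorting the preceding vertices by their triangle [k] turns
    this sum into crossings. *)
Lemma injective_outdeg_mark z j :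
  (injectiveb (fun i => outdeg (mark z) (pos (j, i))))%:R
  = \sum_k cross R pos j k (z j) (z k).
Proof.
have [n0 n1 n10 _] := ord3_others (z j).
transitivity ((\sum_(i | i != z j) rank_off (mark z) (pos (j, i)))%:R : R); last first.
  rewrite natr_sum exchange_big /=; apply: eq_bigr => i _.
  rewrite rank_off_mark natr_sum; apply: eq_bigr => k _.
  by rewrite natr_sum.
rewrite (@injectiveb_ord3 _ (z j)) ?outdeg_eq1 ?mark_pos //; last first.
  by apply/eqP; rewrite outdeg_eq1 mark_pos.
rewrite sum_ord3_others (natr_odd char2 (_ + _)) oddD /outdeg !mark_pos (negPf n0) (negPf n1).
by case: odd; case: odd.
Qed.

(** A nonzero term has exactly one vertex of out-degree 1 in each triangle, so its [f] is [mark z]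
    for a unique [z]. *)
Lemma sum_mark :
  \sum_(f : {ffun 'I_n.+1 -> bool})
     \prod_j (injectiveb (fun i => outdeg f (pos (j, i))))%:R = 1 :> R.
Proof.
(* The default 0 arises only when a triangle has no marked vertex, and then the term of [f] is
   zero. *)
pose marked (f : {ffun 'I_n.+1 -> bool}) := [ffun j => odflt 0 [pick i | f (pos (j, i))]].
rewrite (bigID (fun f => mark (marked f) == f)) /= [X in _ + X]big1 ?addr0; last first.
  move=> f /eqP not_mark.
  have [inj_f | /forallPn [j ninj]] :=
    boolP [forall j, injectiveb (fun i => outdeg f (pos (j, i)))]; last first.
    by rewrite (bigD1 j) //= (negPf ninj) mul0r.
  case: not_mark; apply/ffunP=> p; rewrite -[p]at_posK; case: (at_pos p) => j i {p}.
  rewrite mark_pos ffunE; have /injectiveP f_inj := forallP inj_f j.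
  case: pickP => [i' fi' | no_f] /=; last first.
    have [i'] := inj_le2_onto1 (fun i => outdeg_le2 _ _) f_inj.
    by move/eqP; rewrite outdeg_eq1 no_f.
  apply/eqP/idP => [-> // | fi]; apply: f_inj; apply/eqP.
  by move: fi fi'; rewrite -!outdeg_eq1 => /eqP -> /eqP ->.
rewrite (reindex_onto mark marked) /= => [|f /eqP //].
rewrite -[RHS](sum_cross char2 pos_inj); apply: eq_big => [z | z _].
  have -> : marked (mark z) = z; last by rewrite !eqxx.
  apply/ffunP=> j; rewrite ffunE; case: pickP => [i | /(_ (z j))]; rewrite mark_pos ?eqxx //.
  by move/eqP.
by apply: eq_bigr => j _; rewrite injective_outdeg_mark.
Qed.

Definition colour (s : {ffun J -> 'S_3}) (p : nat) : 'I_3 :=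
  let v := at_pos (inord p) in s v.1 v.2.

(** For a fixed monomial the sum over [s] factors over the triangles into Vandermonde sums, each
    testing whether the three exponents are distinct. *)
Lemma sum_colourings :
  \sum_s (1 + w ^+ colour s n) * w ^+ colour s 0
         * \prod_(i < n) (w ^+ colour s i + w ^+ colour s i.+1) = 1.
Proof.
rewrite -[RHS]sum_mark.
under eq_bigr => s _ do rewrite -(path_expansion (fun p => w ^+ colour s p)).
rewrite exchange_big /=; apply: eq_bigr => f _.
under [RHS]eq_bigr => j _ do rewrite -(vandermonde3 char2 w_root (fun i => outdeg_le2 _ _)).
rewrite bigA_distr_bigA; apply: eq_bigr => s _.
rewrite (reindex pos) /=; last by exists at_pos => i _.
rewrite pair_bigA; apply: eq_bigr => -[j i] _ /=.
by rewrite /colour inord_val posK /= -exprM mulnC.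
Qed.

(** A monochromatic path edge contributes a factor [a + a = 0]; if every colouring had one, the sum
    could not be 1. *)
Lemma colour_proper : exists s, forall i : 'I_n, colour s i != colour s i.+1.
Proof.
have [/existsP [s /forallP s_proper] | /existsPn none] :=
  boolP [exists s, forall i : 'I_n, colour s i != colour s i.+1]; first by exists s.
have := sum_colourings; rewrite big1 => [/esym/eqP|s _]; first by rewrite oner_eq0.
have /forallPn [i /negPn/eqP same] := none s.
by rewrite (bigD1 i) //= same (addrr_pchar2 char2) mul0r mulr0.
Qed.

End PathTriangles.

(** In the field with four elements [w ^+ 4 = w]; factoring shows that every [w] other than 0 and 1
    is a root of [w ^+ 2 + w + 1]. *)
Lemma exists_cube_root_char2 :
  exists2 F : fieldType, 2 \in [pchar F]%R & exists w : F, (w ^+ 2 = w + 1)%R.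
Proof.
have [F charF cardF] := pPrimePowerField (isT : prime 2) (isT : 0 < 2).
exists F => //; have /card_gt0P [w] : 0 < #|~: [set 0; 1 : F]%R|.
  by rewrite cardsCs setCK cardF cards2; case: eqP.
rewrite !inE negb_or => /andP [w0 w1]; exists w.
have : (w * (w - 1) * (w ^+ 2 + w + 1) = 0)%R.
  have w4 : (w ^+ 4 - w = 0)%R by rewrite -[X in (_ - X)%R]expf_card cardF subrr.
  by rewrite -[RHS]w4; ring.
move/eqP; rewrite !mulf_eq0 subr_eq0 (negPf w0) (negPf w1) /= -addrA addr_eq0.
by rewrite (oppr_pchar2 charF) => /eqP.
Qed.

Lemma path_triangles_colouring (J : finType) (s : seq (J * 'I_3)) :
  uniq s -> (forall v, v \in s) ->
  exists2 c : J * 'I_3 -> 'I_3,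
    forall j, injective (fun i => c (j, i)) & sorted (fun u v => c u != c v) s.
Proof.
move=> uniq_s full_s.
(* The empty list is treated apart because positions live in ['I_n.+1]. *)
have [s0 | [v0 s_v0]] : s = [::] \/ exists v0, v0 \in s.
  by case: s {uniq_s full_s} => [|v s]; [left | right; exists v; rewrite mem_head].
  by exists snd => [j i i' | ]; rewrite ?s0.
have [n size_s] : exists n, size s = n.+1 by case: s s_v0 {uniq_s full_s} => // v s _; exists (size s).
pose pos v : 'I_n.+1 := inord (index v s).
pose at_pos (p : 'I_n.+1) := nth v0 s p.
have posK : cancel pos at_pos.
  by move=> v; rewrite /at_pos inordK ?nth_index // -size_s index_mem.
have at_posK : cancel at_pos pos.
  by move=> p; rewrite /pos /at_pos index_uniq ?size_s // inord_val.
have [F charF [w w_root]] := exists_cube_root_char2.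
have [sigma sigma_proper] := colour_proper charF w_root posK at_posK.
exists (fun v => sigma v.1 v.2) => [j i i' /perm_inj // | ].
apply/(sortedP v0) => i; rewrite size_s ltnS => lt_in.
have := sigma_proper (Ordinal lt_in); rewrite /colour /at_pos /= !inordK // ltnW // ltnW //.
Qed.

(** * Haxell's theorem *)

Lemma leq_card_bigcup (T I : finType) (P : {pred I}) (F : I -> {set T}) :
  #|\bigcup_(i in P) F i| <= \sum_(i in P) #|F i|.
Proof.
elim/big_rec2: _ => [|i m D _ le_D]; first by rewrite cards0.
by apply: leq_trans (leq_card_setU _ _) _; rewrite leq_add2l.
Qed.

Lemma card_disjoint_bigcup (T I : finType) (F : I -> {set T}) (B : {set I}) :
  (forall i j, i != j -> [disjoint F i & F j]) ->
  #|\bigcup_(j in B) F j| = \sum_(j in B) #|F j|.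
Proof.
move=> disjF; rewrite -sum1_card.
have -> : \bigcup_(j in B) F j = \bigcup_j (if j \in B then F j else set0) by rewrite big_mkcond.
rewrite partition_disjoint_bigcup => [|i j /disjF disj_ij]; last first.
  by case: ifP => _; case: ifP => _ //; rewrite -setI_eq0 ?set0I ?setI0.
rewrite [RHS]big_mkcond; apply: eq_bigr => j _; case: ifP => _; first by rewrite sum1_card.
by rewrite big_set0.
Qed.

Section IndependentTransversal.

Variables (T I : finType) (h : rel T) (d : nat) (Y : I -> {set T}).
Hypotheses (h_sym : symmetric h) (h_irr : irreflexive h) (deg_h : max_deg_le h d).
Hypotheses (d_gt0 : 0 < d) (cardY : forall j, 2 * d <= #|Y j|).
Hypothesis disjY : forall i j, i != j -> [disjoint Y i & Y j].

Definition transversal_on (K : {set I}) (t : {ffun I -> T}) : Prop :=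
  (forall i, i \in K -> t i \in Y i) /\
  (forall i j, i \in K -> j \in K -> ~~ h (t i) (t j)).

Lemma mem_part_inj i j x : x \in Y i -> x \in Y j -> i = j.
Proof.
move=> xi xj; apply/eqP/negPn/negP => /disjY.
by rewrite disjoint_subset => /subsetP /(_ _ xi); rewrite inE xj.
Qed.

(** * Extending a partial transversal by one class *)

Section Extension.

Variables (K : {set I}) (A : I).
Hypothesis AK : A \notin K.

Definition blockers (t : {ffun I -> T}) (x : T) : {set I} := [set j in K | h x (t j)].

(** The classes in play: the new class [A], and those whose representatives block a vertex of the
    search sequence. *)
Definition reached t (xs : seq T) : {set I} :=
  foldr (fun x B => blockers t x :|: B) [set A] xs.

Definition avoids (t : {ffun I -> T}) (x : T) (xs : seq T) : Prop :=
  forall y, y \in xs -> ~~ h x y /\ forall j, j \in blockers t y -> ~~ h x (t j).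

(* The search sequence of Haxell's proof, most recent vertex first. *)
Fixpoint chain (t : {ffun I -> T}) (xs : seq T) : Prop :=
  if xs is x :: r then
    [/\ chain t r, exists2 j, j \in reached t r & x \in Y j, avoids t x r
      & forall y, y \in r -> blockers t y != set0]
  else True.

Lemma reachedP t xs j :
  reflect (j = A \/ exists2 y, y \in xs & j \in blockers t y) (j \in reached t xs).
Proof.
elim: xs => [|x r IH] /=.
  by rewrite inE; apply: (iffP eqP) => [|[// | [y]]]; [left | rewrite in_nil].
rewrite inE; apply: (iffP orP) => [[jx | /IH [-> | [y yr jy]]] | [jA | [y]]].
- by right; exists x; rewrite ?mem_head.
- by left.
- by right; exists y; rewrite // inE yr orbT.
- by right; apply/IH; left.
- rewrite inE => /predU1P [-> | yr] jy; first by left.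
  by right; apply/IH; right; exists y.
Qed.

Lemma card_blockers t x : transversal_on K t -> #|blockers t x| <= d.
Proof.
move=> [tY _]; apply: leq_trans (deg_h x); rewrite /deg.
have t_inj : {in blockers t x &, injective t}.
  move=> i j; rewrite !inE => /andP [iK _] /andP [jK _] eq_t.
  by apply: mem_part_inj (tY _ iK) _; rewrite eq_t tY.
rewrite -(card_in_imset t_inj); apply/subset_leq_card/subsetP => _ /imsetP [j jx ->].
by move: jx; rewrite !inE => /andP [].
Qed.

Lemma avoids_notin t x r :
  avoids t x r -> (forall y, y \in r -> blockers t y != set0) -> x \notin r.
Proof.
move=> av ne; apply/negP => xr; have [_ no] := av x xr.
by have /set0Pn [j jx] := ne x xr; have := no j jx; move: jx; rewrite inE => /andP [_ ->].
Qed.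

Lemma chain_uniq t xs : chain t xs -> uniq xs.
Proof.
elim: xs => //= x r IH [cr _ av ne]; rewrite IH // andbT.
exact: avoids_notin av ne.
Qed.

Lemma chain_cat t l xs : chain t (l ++ xs) -> chain t xs.
Proof. by elim: l => //= x l IH [/IH]. Qed.

(** The blocker sets are disjoint, as each new vertex avoids the representatives blocking older
    ones; none contains [A], which lies outside [K]. *)
Lemma card_reached t xs : chain t xs -> #|reached t xs| = (\sum_(x <- xs) #|blockers t x|).+1.
Proof.
elim: xs => [|x r IH] /=; first by rewrite big_nil cards1.
case=> cr _ av _; rewrite big_cons cardsU (IH cr) addnS.
rewrite (_ : _ :&: _ = set0) ?cards0 ?subn0 //; apply/eqP/set0Pn => -[j].
rewrite inE => /andP []; rewrite inE => /andP [jK hxj] /reachedP [jA | [y yr jy]].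
  by rewrite jA (negPf AK) in jK.
by have [_ /(_ j jy)] := av y yr; rewrite hxj.
Qed.

Lemma card_bigcup_part (B : {set I}) : 2 * d * #|B| <= #|\bigcup_(j in B) Y j|.
Proof.
rewrite card_disjoint_bigcup // mulnC -sum_nat_const.
exact: leq_sum.
Qed.

(** A vertex with b > 0 blockers dominates, together with them, at most d + d b <= 2 d b vertices.
    The reached classes, one more than the blockers in total, hold at least 2 d vertices each, so
    one vertex is undominated. *)
Lemma chain_extend t xs : transversal_on K t -> chain t xs ->
  (forall y, y \in xs -> blockers t y != set0) -> exists x, chain t (x :: xs).
Proof.
move=> tK cx ne.
pose dom := \bigcup_(y in xs) (nbhd h y :|: \bigcup_(j in blockers t y) nbhd h (t j)).
have card_dom : #|dom| <= 2 * d * \sum_(y <- xs) #|blockers t y|.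
  rewrite (leq_trans (leq_card_bigcup _ _)) // big_uniq ?(chain_uniq cx) // big_distrr.
  apply: leq_sum => y yx; apply: leq_trans (leq_card_setU _ _) _.
  have le1 : #|nbhd h y| <= d := deg_h y.
  have le2 : \sum_(j in blockers t y) #|nbhd h (t j)| <= #|blockers t y| * d.
    by rewrite -sum_nat_const; apply: leq_sum => j _; apply: deg_h.
  have := leq_add le1 (leq_trans (leq_card_bigcup _ _) le2); move/leq_trans; apply.
  have : 0 < #|blockers t y| by rewrite card_gt0 ne.
  by move: #|_| => b /=; nia.
have : ~~ (\bigcup_(j in reached t xs) Y j \subset dom).
  apply/negP => /subset_leq_card; apply/negP; rewrite -ltnNge.
  apply: leq_trans (card_bigcup_part _); rewrite (card_reached cx).
  by apply: leq_ltn_trans card_dom _; rewrite ltn_pmul2l // muln_gt0 d_gt0.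
case/subsetPn => x /bigcupP [j jr xj] xdom; exists x; split=> //; first by exists j.
move=> y yx; split=> [|i iy].
  apply: contra xdom => hxy; apply/bigcupP; exists y => //.
  by rewrite !inE h_sym hxy.
apply: contra xdom => hxy; apply/bigcupP; exists y => //.
by rewrite inE; apply/orP; right; apply/bigcupP; exists i; rewrite // inE h_sym.
Qed.

(** Only [behead xs] matters, since [chain] does not constrain the blockers of the newest vertex; a
    swap may therefore change those. *)
Lemma eq_chain t t' xs :
  (forall z, z \in behead xs ->
     blockers t' z = blockers t z /\ forall i, i \in blockers t z -> t' i = t i) ->
  chain t xs -> chain t' xs.
Proof.
elim: xs => //= x r IH same [cr [j jr xj] av ne].
have same_reached : reached t' r = reached t r.
  elim: (r) same => //= y l IHl same; rewrite IHl => [|z zl]; last by apply: same; rewrite inE zl orbT.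
  by have [-> _] := same y (mem_head _ _).
split.
- by apply: IH cr => z zr; apply: same; apply: mem_behead.
- by exists j; rewrite ?same_reached.
- move=> y yr; have [nxy no] := av y yr; have [-> eq_t] := same y yr.
  by split=> // i iy; rewrite eq_t ?no.
- by move=> y yr; have [-> _] := same y yr; apply: ne.
Qed.

(** The free vertex [x] replaces the representative [t j] that blocks [y]. As [x] is adjacent to no
    earlier vertex, no blocker is gained and [y] loses [j]; the sequence is cut back to [y]. *)
Lemma chain_swap t x l y r j : transversal_on K t -> chain t (x :: l ++ y :: r) ->
  blockers t x = set0 -> j \in blockers t y -> x \in Y j ->
  [/\ transversal_on K (upd t j x), chain (upd t j x) (y :: r),
      blockers (upd t j x) y = blockers t y :\ j
    & forall z, z \in r -> blockers (upd t j x) z = blockers t z].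
Proof.
move=> [tY tI] /= [clyr _ av ne] free jy xj.
have [cr _ avy _] := chain_cat clyr.
have nx i : i \in K -> ~~ h x (t i).
  by move=> iK; apply/negP => hxi; have := in_set0 i; rewrite -free inE iK hxi.
have updB z : z \in l ++ y :: r -> blockers (upd t j x) z = blockers t z :\ j.
  move=> zl; apply/setP=> i; rewrite !inE ffunE; case: eqP => [-> | //] /=.
  by rewrite h_sym; have [/negPf -> _] := av z zl; rewrite andbF.
have mem_r z : z \in r -> z \in l ++ y :: r by move=> zr; rewrite mem_cat inE zr !orbT.
have jr z : z \in r -> j \notin blockers t z.
  move=> zr; apply/negP => jz; have [_ /(_ _ jz)] := avy z zr.
  by move: jy; rewrite inE => /andP [_ ->].
have updBr z : z \in r -> blockers (upd t j x) z = blockers t z.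
  by move=> zr; rewrite (updB _ (mem_r _ zr)); apply/setDidPl; rewrite disjoint_sym disjoints1 jr.
split=> //.
- split=> [i iK | i i' iK i'K]; first by rewrite ffunE; case: eqP => [-> // | _]; exact: tY.
  rewrite !ffunE; case: eqP => _; case: eqP => _; rewrite ?h_irr ?nx ?tI //.
  by rewrite h_sym nx.
- apply: eq_chain (chain_cat clyr) => z zr; split; first exact: updBr.
  by move=> i iz; rewrite ffunE; case: eqP => // ij; have := jr z zr; rewrite -ij iz.
- by rewrite updB // mem_cat mem_head orbT.
Qed.

(** Blocker counts in base [d + 2], oldest vertex most significant, encode the lexicographic order
    of the search as a number. *)
Definition digits t xs := foldr (fun x v => d.+2 * v + #|blockers t x|) 0 xs.

(* [digits t xs] padded to length [#|T|] by the unused digit [d + 1], plus 1. *)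
Definition weight t xs := (digits t xs).+1 * d.+2 ^ (#|T| - size xs).

(** The new digit is at most d and replaces a padding digit d + 1. *)
Lemma weight_cons t x xs : transversal_on K t -> size xs < #|T| ->
  weight t (x :: xs) < weight t xs.
Proof.
move=> tK lt_size; have := card_blockers x tK; rewrite /weight /=.
rewrite -(subnSK lt_size) expnS mulnA ltn_pmul2r ?expn_gt0 //.
by move: #|blockers t x| (digits t xs) => a v; nia.
Qed.

Lemma digits_cat t l xs : digits t xs * d.+2 ^ size l <= digits t (l ++ xs).
Proof.
elim: l => [|x l IH] /=; first by rewrite expn0 muln1.
by rewrite expnS mulnCA; apply: leq_trans (leq_addr _ _); rewrite leq_pmul2l.
Qed.

(** The digit of [y] drops by one, whatever came after it. The successor in [weight] makes up
    exactly for the lost blocker, and the successor on the other side makes the inequality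
    strict. *)
Lemma weight_swap t t' l y r j : size (l ++ y :: r) <= #|T| -> j \in blockers t y ->
  blockers t' y = blockers t y :\ j -> (forall z, z \in r -> blockers t' z = blockers t z) ->
  weight t' (y :: r) < weight t (l ++ y :: r).
Proof.
move=> le_size jy t'y t'r; have same_r : digits t' r = digits t r.
  elim: (r) t'r => //= z s IH t's; rewrite IH => [|u us]; last by apply: t's; rewrite inE us orbT.
  by rewrite t's ?mem_head.
have -> : weight t' (y :: r) = digits t (y :: r) * d.+2 ^ (#|T| - size (y :: r)).
  by rewrite /weight /= same_r t'y -addnS [in RHS](cardsD1 j) jy.
have -> : #|T| - size (y :: r) = size l + (#|T| - size (l ++ y :: r)).
  by move: le_size; rewrite size_cat /=; lia.
rewrite expnD mulnA /weight ltn_pmul2r ?expn_gt0 // ltnS.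
exact: digits_cat.
Qed.

(** If the newest vertex is free, it either represents [A] or allows a swap; if blocked, the
    sequence is extended. Swaps and extensions both lower the weight. *)
Lemma transversal_extend t : transversal_on K t -> exists t', transversal_on (A |: K) t'.
Proof.
move=> tK.
have [x0 x0A] : exists x, x \in Y A.
  apply/card_gt0P; apply: leq_trans (cardY A); by rewrite muln_gt0 d_gt0.
have : chain t [:: x0] by split=> //; exists A; rewrite // inE.
(* The induction runs over arbitrary nonempty sequences, not only the initial one. *)
have [m] := ubnP (weight t [:: x0]); move: (nil) => r; move: x0 {x0A} => x.
elim: m => // m IH in t tK x r *; rewrite ltnS => le_m cx.
have le_size : size (x :: r) <= #|T|.
  by rewrite -(card_uniqP (chain_uniq cx)) max_card.
have [free | blocked] := eqVneq (blockers t x) set0.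
  have [_ [j /reachedP [-> | [y yr jy]] xj] av _] := cx.
    exists (upd t A x); case: tK => tY tI.
    have nx i : i \in K -> ~~ h x (t i).
      by move=> iK; apply/negP => hxi; have := in_set0 i; rewrite -free inE iK hxi.
    split=> [i | i i']; rewrite !inE !ffunE.
      by case: eqP => [-> // | _] /=; exact: tY.
    case: eqP => _; case: eqP => _ //= iK i'K; rewrite ?h_irr ?nx ?tI //.
    by rewrite h_sym nx.
  case/splitPr: yr => l s in av cx le_size le_m *.
  have [tK' cs t'y t's] := chain_swap tK cx free jy xj.
  apply: (IH _ tK' y s) cs; apply: leq_trans le_m.
  by apply: (weight_swap (l := x :: l)) jy t'y t's.
have [x' cx'] : exists x', chain t (x' :: x :: r).
  apply: chain_extend => // y; rewrite inE => /predU1P [-> // | yr].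
  by case: cx => _ _ _; apply.
apply: (IH _ tK x') (cx'); apply: leq_trans le_m; apply: weight_cons => //.
by have := max_card (mem (x' :: x :: r)); rewrite (card_uniqP (chain_uniq cx')).
Qed.

End Extension.

Lemma independent_transversal : exists t, transversal_on setT t.
Proof.
have nonempty j : exists x, x \in Y j.
  by apply/card_gt0P; apply: leq_trans (cardY j); rewrite muln_gt0 d_gt0.
pose t0 := [ffun j => xchoose (nonempty j)].
have [t tI] : exists t, transversal_on [set i in enum I] t.
  elim: (enum I) => [|i s [t tI]]; first by exists t0; split=> i; rewrite inE.
  have -> : [set j in i :: s] = i |: [set j in s] by apply/setP=> j; rewrite !inE.
  have [si | nsi] := boolP (i \in s); last by apply: (transversal_extend _ tI); rewrite inE.
  by exists t; rewrite (setUidPr _) // sub1set inE.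
exists t; suff <- : [set i in enum I] = setT by [].
by apply/setP=> i; rewrite !inE mem_enum.
Qed.

End IndependentTransversal.

(** * Linear forests *)

Section PathListing.

Variables (T : finType) (h : rel T).
Hypotheses (h_sym : symmetric h) (h_irr : irreflexive h) (deg_h : max_deg_le h 2).

(** Acyclicity phrased as 1-degeneracy, which passes to subsets at once. *)
Definition forest_on (W : {set T}) : Prop :=
  forall V : {set T}, V \subset W -> V != set0 ->
    exists2 v, v \in V & #|nbhd h v :&: V| <= 1.

(** If all degrees inside [V] are at least 2, the bound 2 on the degree makes [V] closed under
    adjacency, so it contains a whole cycle component. *)
Lemma forest_without_cycles (W : {set T}) :
  (forall C, cycle_component h C -> ~~ (C \subset W)) -> forest_on W.
Proof.
move=> noC V VW /set0Pn [v vV].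
have [/exists_inP [u uV low] | /exists_inPn high] :=
  boolP [exists u in V, #|nbhd h u :&: V| <= 1]; first by exists u.
have full u : u \in V -> nbhd h u \subset V /\ deg h u = 2.
  move=> uV; have := high u uV; rewrite -ltnNge => gt1.
  have le2 := deg_h u; rewrite /deg in le2 *.
  have sub := subset_leq_card (subsetIl (nbhd h u) V).
  split; last by apply/eqP; rewrite eqn_leq le2 (leq_trans gt1).
  by apply/setIidPl/eqP; rewrite eqEcard subsetIl (leq_trans le2).
have V_closed : closed h V.
  apply: (intro_closed (sym_connect_sym h_sym)) => x y hxy xV.
  by apply: (subsetP (full x xV).1); rewrite inE.
have CV : component h v \subset V.
  by apply/subsetP=> y; rewrite inE => /(closed_connect V_closed) <-.
have cyc : cycle_component h (component h v).
  by split=> [|y /(subsetP CV) yV]; [exists v | case: (full y yV)].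
by have := noC _ cyc; rewrite (subset_trans CV VW).
Qed.

(** All edges inside [W] join consecutive entries of [s], in the form needed later, where [r] says
    that two colours differ. Consecutive entries need not be adjacent. *)
Definition lists_edges (W : {set T}) (s : seq T) : Prop :=
  [/\ uniq s, s =i W
    & forall r : rel T, symmetric r -> sorted r s -> {in W &, forall u v, h u v -> r u v}].

(** Peel off the end vertex [v] and continue at its neighbour, whose degree drops to at most 1. If
    there is none, a new path starts at any end vertex of the rest. *)
Lemma forest_listing_from (W : {set T}) v :
  forest_on W -> v \in W -> #|nbhd h v :&: W| <= 1 -> exists s, lists_edges W (v :: s).
Proof.
have [n] := ubnP #|W|; elim: n => // n IH in W v *; rewrite ltnS => le_n forW vW low.
have cardW' : #|W :\ v| < n by apply: leq_trans le_n; rewrite [in X in _ < X](cardsD1 v) vW.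
have forW' : forest_on (W :\ v).
  by move=> V VW; apply: forW; apply: subset_trans VW (subsetDl _ _).
have [W'0 | nW'0] := eqVneq (W :\ v) set0.
  have Wv x : x \in W -> x = v.
    by move=> xW; apply/eqP; have := in_set0 x; rewrite -W'0 !inE xW andbT => /negbFE.
  exists [::]; split=> // [x | r _ _ x y /Wv -> /Wv ->]; last by rewrite h_irr.
  by rewrite inE; apply/eqP/idP => [-> | /Wv].
have [w [wW' loww only_w]] : exists w, [/\ w \in W :\ v, #|nbhd h w :&: (W :\ v)| <= 1
    & forall x, x \in W -> h v x -> x = w].
  have [none | [w]] := set_0Vmem (nbhd h v :&: W).
    have [w wW' loww] := forW' _ (subxx _) nW'0; exists w; split=> // x xW hvx.
    by have := in_set0 x; rewrite -none !inE hvx xW.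
  rewrite !inE => /andP [hvw wW]; exists w; split.
  - by rewrite !inE wW andbT; apply: contraTneq hvw => ->; rewrite h_irr.
  - rewrite -ltnS; apply: leq_trans (deg_h w); rewrite /deg.
    apply/proper_card/properP; split; first exact: subsetIl.
    by exists v; rewrite !inE ?eqxx ?andbF // h_sym.
  - by move=> x xW hvx; apply: (card_le1_eqP low); rewrite !inE ?hvx ?hvw.
have [s [uniq_s s_W' s_edges]] := IH _ w cardW' forW' wW' loww.
exists (w :: s); split.
- by rewrite cons_uniq uniq_s s_W' !inE eqxx.
- move=> x; rewrite in_cons s_W' !inE; by case: eqP => // ->.
- move=> r r_sym /= /andP [rvw sorted_s] x y xW yW.
  have [-> /(only_w _ yW) -> // | nxv] := eqVneq x v.
  have [-> | nyv] := eqVneq y v.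
    by rewrite h_sym r_sym => /(only_w _ xW) ->.
  by apply: (s_edges r r_sym sorted_s); rewrite !inE ?nxv ?nyv.
Qed.

Lemma forest_listing (W : {set T}) : forest_on W -> exists s, lists_edges W s.
Proof.
move=> forW; have [-> | nW0] := eqVneq W set0.
  by exists [::]; split=> // [x | r _ _ x y]; rewrite inE.
have [v vW low] := forW W (subxx _) nW0.
by have [s] := forest_listing_from forW vW low; exists (v :: s).
Qed.

End PathListing.

(** * Transversals missing few cycles *)

Section MissedCycles.

Variables (T I : finType) (h : rel T) (Y : I -> {set T}).
Hypotheses (h_sym : symmetric h) (h_irr : irreflexive h) (deg_h : max_deg_le h 2).
Hypothesis cardY : forall j, #|Y j| = 4.
Hypothesis disjY : forall i j, i != j -> [disjoint Y i & Y j].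

Definition covered_cycles : {set {set T}} :=
  [set C : {set T} | [&& [exists x, C == component h x], [forall y in C, deg h y == 2]
     & C \subset \bigcup_j Y j]].

Definition missed (t : {ffun I -> T}) : {set {set T}} :=
  [set C in covered_cycles | [forall j, t j \notin C]].

Definition hits (t : {ffun I -> T}) (C : {set T}) : {set I} := [set j | t j \in C].

Lemma component_mem x y : y \in component h x -> component h y = component h x.
Proof.
rewrite inE => cxy; apply/setP=> z; rewrite !inE.
by rewrite (same_connect (sym_connect_sym h_sym) cxy).
Qed.

Lemma covered_cycleP C :
  reflect (cycle_component h C /\ C \subset \bigcup_j Y j) (C \in covered_cycles).
Proof.
rewrite inE; apply: (iffP and3P) => [[/existsP [x /eqP ->] /forall_inP deg2 ->] | [[[x ->] deg2] ->]].
  by split=> //; split; [exists x | move=> y /deg2 /eqP].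
by split=> //; [apply/existsP; exists x | apply/forall_inP=> y /deg2 ->].
Qed.

Lemma cycle_eq_component C x : cycle_component h C -> x \in C -> C = component h x.
Proof. by case=> -[y ->] _ xy; rewrite (component_mem xy). Qed.

Lemma cycle_unique C D x : cycle_component h C -> cycle_component h D ->
  x \in C -> x \in D -> C = D.
Proof. by move=> cC cD xC xD; rewrite (cycle_eq_component cC xC) (cycle_eq_component cD xD). Qed.

Lemma cycle_closed C x y : cycle_component h C -> x \in C -> h x y -> y \in C.
Proof. by move=> cC xC hxy; rewrite (cycle_eq_component cC xC) inE connect1. Qed.

Lemma cycle_nbhd C x : cycle_component h C -> x \in C ->
  x |: nbhd h x \subset C /\ #|x |: nbhd h x| = 3.
Proof.
move=> cC xC; split.
  by rewrite subUset sub1set xC; apply/subsetP=> y; rewrite inE; apply: cycle_closed.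
by case: cC => _ /(_ _ xC); rewrite /deg cardsU1 inE h_irr => ->.
Qed.

Lemma card_cycle C : cycle_component h C -> 2 < #|C|.
Proof.
move=> cC; have [x xC] : exists x, x \in C by case: cC => -[x ->] _; exists x; rewrite inE.
by have [/subset_leq_card le <-] := cycle_nbhd cC xC.
Qed.

Lemma cycle_triangle C : cycle_component h C -> #|C| = 3 -> C \in triangles h.
Proof.
move=> cC C3; rewrite inE C3; apply/forall_inP=> x xC; apply/forall_inP=> y yC.
have [sub N3] := cycle_nbhd cC xC; apply/implyP=> nxy.
have : y \in x |: nbhd h x by rewrite (_ : _ |: _ = C) //; apply/eqP; rewrite eqEcard sub C3 N3.
by rewrite !inE eq_sym (negPf nxy).
Qed.

Lemma mem_missed (t : {ffun I -> T}) C :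
  reflect (C \in covered_cycles /\ forall j, t j \notin C) (C \in missed t).
Proof. by rewrite [X in reflect _ X]in_set; apply: (iffP andP) => -[gC /forallP]. Qed.

Definition transversal (t : {ffun I -> T}) : bool :=
  [forall j, t j \in Y j] && [forall i, forall j, ~~ h (t i) (t j)].

Lemma transversalP t : reflect (transversal_on h Y setT t) (transversal t).
Proof.
apply: (iffP andP) => [[/forallP tY /forallP tI] | [tY tI]].
  by split=> [i _ | i j _ _]; [exact: tY | exact: (forallP (tI i))].
split; apply/forallP=> i; first by rewrite tY.
by apply/forallP=> j; rewrite tI.
Qed.

(** * A single swap *)

Section Swap.

Variables (t : {ffun I -> T}) (C : {set T}) (j : I) (u : T).
Hypotheses (tT : transversal t) (Ct : C \in missed t) (uC : u \in C) (uj : u \in Y j).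

Let cC : cycle_component h C.
Proof. by case/mem_missed: Ct => /covered_cycleP []. Qed.

(** All neighbours of [u] lie on the missed cycle [C], so none of them is a representative. *)
Lemma transversal_swap : transversal (upd t j u).
Proof.
have /transversalP [tY tI] := tT; apply/transversalP.
have /mem_missed [_ noC] := Ct.
have nu i : ~~ h u (t i) by apply: contra (noC i); exact: cycle_closed.
split=> [i _ | i i' _ _]; rewrite !ffunE; first by case: eqP => [-> | _] //; rewrite tY.
case: eqP => _; case: eqP => _; rewrite ?h_irr ?nu ?tI ?inE //.
by rewrite h_sym nu.
Qed.

Hypothesis minimal : #|missed t| <= #|missed (upd t j u)|.

(** The swap hits [C], so by minimality another cycle becomes missed. It was hit by [t j] alone, and
    [t j] lies on only one cycle, so the number of missed cycles is unchanged. *)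
Lemma swap_target : exists C',
  [/\ C' \in missed (upd t j u), hits t C' = [set j], C' != C & #|missed (upd t j u)| = #|missed t|].
Proof.
have updC : C \notin missed (upd t j u).
  by apply/negP => /mem_missed [_ /(_ j)]; rewrite ffunE eqxx uC.
have [sub | /subsetPn [C' C't' C't]] := boolP (missed (upd t j u) \subset missed t).
  have : missed (upd t j u) = missed t by apply/eqP; rewrite eqEcard sub.
  by move=> eq_m; rewrite eq_m Ct in updC.
have /mem_missed [gC' noC'] := C't'; have /covered_cycleP [cC' _] := gC'.
have hit i : t i \in C' -> i = j.
  by move=> ti; apply/eqP; apply: contraTT ti => nij; have := noC' i; rewrite ffunE (negPf nij).
have tj : t j \in C'.
  apply: contraR C't => tj; apply/mem_missed; split=> // i.
  by apply/negP => ti; move: tj; rewrite -(hit i ti) ti.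
exists C'; split=> //.
- by apply/setP=> i; rewrite !inE; apply/idP/eqP => [/hit | ->].
- by apply: contraNneq updC => <-.
have sub : missed (upd t j u) \subset C' |: (missed t :\ C).
  apply/subsetP=> D Dt'; rewrite in_setU1 in_setD1; have [//= | nDC'] := eqVneq D C'.
  have -> /= : D != C by apply: contraNneq updC => <-.
  have /mem_missed [gD noD] := Dt'; have /covered_cycleP [cD _] := gD.
  apply/mem_missed; split=> // i; have := noD i; rewrite ffunE; case: eqP => [-> _ | _ //].
  by apply: contra nDC' => tjD; apply/eqP; apply: cycle_unique tjD tj.
apply/eqP; rewrite eqn_leq minimal andbT (leq_trans (subset_leq_card sub)) //.
by rewrite (leq_trans (leq_card_setU _ _)) // cards1 [X in _ <= X](cardsD1 C) Ct.
Qed.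

End Swap.

Definition swap_step (t t' : {ffun I -> T}) : bool :=
  [exists C in missed t, exists j, exists u in C :&: Y j, t' == upd t j u].

Lemma swap_stepP t t' :
  reflect (exists C j u, [/\ C \in missed t, u \in C, u \in Y j & t' = upd t j u])
          (swap_step t t').
Proof.
apply: (iffP exists_inP) => [[C Ct /existsP [j /exists_inP [u]]] | [C [j [u [Ct uC uj ->]]]]].
  by rewrite inE => /andP [uC uj] /eqP ->; exists C, j, u.
by exists C => //; apply/existsP; exists j; apply/exists_inP; exists u; rewrite ?inE ?uC.
Qed.

(** * Swap sequences from a minimal transversal *)

Section Minimum.

Variable t0 : {ffun I -> T}.
Hypothesis t0T : transversal t0.
Hypothesis t0_min : forall t, transversal t -> #|missed t0| <= #|missed t|.

Lemma reachable_min t : connect swap_step t0 t -> transversal t /\ #|missed t| = #|missed t0|.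
Proof.
case/connectP => p + ->; elim/last_ind: p => [|p t' IH] //.
rewrite rcons_path last_rcons => /andP [/IH [tT tm]] {IH}.
move: (last t0 p) tT tm => {}t tT tm /swap_stepP [C [j [u [Ct uC uj ->]]]].
have t'T := transversal_swap tT Ct uC uj; split=> //.
have le : #|missed t| <= #|missed (upd t j u)| by rewrite tm t0_min.
by case: (swap_target Ct uC le) => C' [_ _ _ ->].
Qed.

Lemma reachable_swap t C j u : connect swap_step t0 t -> C \in missed t ->
  u \in C -> u \in Y j ->
  connect swap_step t0 (upd t j u) /\
  exists C', [/\ C' \in missed (upd t j u), hits t C' = [set j] & C' != C].
Proof.
move=> t0t Ct uC uj; have [tT tm] := reachable_min t0t.
split; first by apply: connect_trans t0t (connect1 _); apply/swap_stepP; exists C, j, u.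
have le : #|missed t| <= #|missed (upd t j u)|.
  by rewrite tm t0_min // (transversal_swap tT Ct uC uj).
by have [C' []] := swap_target Ct uC le; exists C'.
Qed.

Lemma reachable_invariant (P : pred {ffun I -> T}) :
  (forall t C j u, connect swap_step t0 t -> C \in missed t -> u \in C -> u \in Y j ->
     P (upd t j u) = P t) ->
  forall t, connect swap_step t0 t -> P t = P t0.
Proof.
move=> invP t /connectP [p + ->]; elim/last_ind: p => [|p t' IH] //.
rewrite rcons_path last_rcons => /andP [t0p]; rewrite -(IH t0p).
have : connect swap_step t0 (last t0 p) by apply/connectP; exists p.
by move: (last t0 p) => t1 t0t1 /swap_stepP [C [j [u [Ct uC uj ->]]]]; apply: invP t0t1 Ct uC uj.
Qed.

Definition reach_missed : {set {set T}} :=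
  [set C | [exists t, connect swap_step t0 t && (C \in missed t)]].

Lemma reach_missedP C :
  reflect (exists2 t, connect swap_step t0 t & C \in missed t) (C \in reach_missed).
Proof. by rewrite inE; apply: (iffP existsP) => -[t] => [/andP [] | ? ?]; exists t => //; apply/andP. Qed.

Lemma reach_missed_cycle C : C \in reach_missed -> cycle_component h C /\ C \subset \bigcup_j Y j.
Proof. by case/reach_missedP => t _ /mem_missed [/covered_cycleP]. Qed.

(** Having at most one hit is invariant under swaps: one cycle goes from 0 hits to 1, another from 1
    to 0, and the rest keep theirs. It holds at the moment when [C] is missed. *)
Lemma hits_le1 C : C \in reach_missed -> #|hits t0 C| <= 1.
Proof.
case/reach_missedP => t t0t Ct.
have <- : (#|hits t C| <= 1) = (#|hits t0 C| <= 1).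
  have /mem_missed [/covered_cycleP [cC _] _] := Ct.
  apply: (reachable_invariant (P := fun t => #|hits t C| <= 1)) t0t => {Ct}t D j u t0t Dt uD uj.
  have /mem_missed [/covered_cycleP [cD _] noD] := Dt.
  have [_ [D' [D't' hitD' nD'D]]] := reachable_swap t0t Dt uD uj.
  have /mem_missed [/covered_cycleP [cD' _] noD'] := D't'.
  have [-> | nCD'] := eqVneq C D'.
    rewrite hitD' cards1 (_ : hits _ D' = set0) ?cards0 //.
    by apply/setP=> i; rewrite !inE (negPf (noD' i)).
  have [-> | nCD] := eqVneq C D.
    rewrite (_ : hits (upd t j u) D = [set j]); last first.
      by apply/setP=> i; rewrite !inE ffunE; case: eqP => // _; rewrite (negPf (noD i)).
    rewrite cards1 (_ : hits t D = set0) ?cards0 //.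
    by apply/setP=> i; rewrite !inE (negPf (noD i)).
  suff -> : hits (upd t j u) C = hits t C by [].
  apply/setP=> i; rewrite !inE ffunE; case: eqP => // ->.
  have tjD' : t j \in D' by have := set11 j; rewrite -hitD' inE.
  transitivity false; last apply/esym.
    by apply: contraNF nCD => uC; apply/eqP; apply: cycle_unique uC uD.
  by apply: contraNF nCD' => tjC; apply/eqP; apply: cycle_unique tjC tjD'.
rewrite (_ : hits t C = set0) ?cards0 //; apply/setP=> i; rewrite !inE.
by have /mem_missed [_ noC] := Ct; rewrite (negPf (noC i)).
Qed.

(** A swap moves a representative from one cycle of [reach_missed] to another, so lying on such a
    cycle is invariant. When [C] is missed, swapping in [u] shows that the current [t j] lies on
    one. *)
Lemma class_meets_reach C u j : C \in reach_missed -> u \in C -> u \in Y j ->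
  t0 j \in cover reach_missed.
Proof.
case/reach_missedP => t t0t Ct uC uj.
have stay t1 D i v : connect swap_step t0 t1 -> D \in missed t1 -> v \in D -> v \in Y i ->
    t1 i \in cover reach_missed /\ v \in cover reach_missed.
  move=> t0t1 Dt1 vD vi; have [t0t2 [D' [D't2 hitD' _]]] := reachable_swap t0t1 Dt1 vD vi.
  split; apply/bigcupP; last by exists D => //; apply/reach_missedP; exists t1.
  exists D'; first by apply/reach_missedP; exists (upd t1 i v).
  by have := set11 i; rewrite -hitD' inE.
have <- : (t j \in cover reach_missed) = (t0 j \in cover reach_missed).
  apply: (reachable_invariant (P := fun t => t j \in cover reach_missed)) t0t.
  move=> {Ct uC uj}t1 D i v t0t1 Dt1 vD vi; rewrite ffunE; case: eqP => // ->.
  by have [-> ->] := stay _ _ _ _ t0t1 Dt1 vD vi.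
by case: (stay _ _ _ _ t0t Ct uC uj).
Qed.

Lemma reach_trivIset : trivIset reach_missed.
Proof.
apply/trivIsetP => C D /reach_missed_cycle [cC _] /reach_missed_cycle [cD _].
apply: contraR => /pred0Pn [x /andP [/= xC xD]].
by apply/eqP; apply: cycle_unique xC xD.
Qed.

Lemma four_missed_le : 4 * #|missed t0| <= #|triangles h|.
Proof.
pose J := [set j | t0 j \in cover reach_missed].
have missed_sub : missed t0 \subset reach_missed.
  by apply/subsetP=> C Ct0; apply/reach_missedP; exists t0.
(* Cycles missed by [t0] have no hit, and the other cycles of [reach_missed] at most one. *)
have cardJ : #|J| + #|missed t0| <= #|reach_missed|.
  have subJ : J \subset \bigcup_(C in reach_missed) hits t0 C.
    apply/subsetP=> j; rewrite inE => /bigcupP [C CR tC].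
    by apply/bigcupP; exists C; rewrite // inE.
  rewrite -(cardsID (missed t0) reach_missed) (setIidPr missed_sub) addnC leq_add2l.
  apply: leq_trans (subset_leq_card subJ) _; apply: leq_trans (leq_card_bigcup _ _) _.
  rewrite -sum1_card big_mkcond [X in _ <= X]big_mkcond; apply: leq_sum => C _.
  rewrite in_setD; have [/hits_le1 | //] := boolP (C \in reach_missed).
  have [/mem_missed [_ noC] _ | //] := boolP (C \in missed t0).
  by rewrite leqn0 cards_eq0; apply/eqP/setP=> j; rewrite !inE (negPf (noC j)).
have cover_le : \sum_(C in reach_missed) #|C| <= 4 * #|J|.
  rewrite (eqP reach_trivIset).
  have sub : cover reach_missed \subset \bigcup_(j in J) Y j.
    apply/subsetP=> u /bigcupP [C CR uC]; have [_ /subsetP /(_ u uC)] := reach_missed_cycle CR.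
    by case/bigcupP => j _ uj; apply/bigcupP; exists j; rewrite // inE (class_meets_reach CR uC uj).
  apply: leq_trans (subset_leq_card sub) _; rewrite card_disjoint_bigcup //.
  by rewrite mulnC -sum_nat_const; apply: leq_sum => j _; rewrite cardY.
pose R3 := [set C in reach_missed | #|C| == 3].
have R3_triangles : R3 \subset triangles h.
  apply/subsetP=> C; rewrite inE => /andP [/reach_missed_cycle [cC _] /eqP].
  exact: cycle_triangle.
(* Only cycles of length 3 fall short of 4 vertices, each by one. *)
have : 4 * #|reach_missed| <= \sum_(C in reach_missed) #|C| + #|R3|.
  have -> : #|R3| = \sum_(C in reach_missed) (#|C| == 3).
    rewrite -sum1_card big_mkcond [RHS]big_mkcond; apply: eq_bigr => C _.
    by rewrite in_set; case: (C \in _); case: eqP.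
  rewrite -big_split mulnC -sum_nat_const /=.
  apply: leq_sum => C /reach_missed_cycle [/card_cycle].
  by rewrite leq_eqVlt eq_sym; case: eqP => [-> // | _] /= ? _; rewrite addn0.
have := subset_leq_card R3_triangles; lia.
Qed.

End Minimum.

Lemma transversal_few_missed : exists t,
  transversal_on h Y setT t /\ 4 * #|missed t| <= #|triangles h|.
Proof.
have [// | j | t /transversalP tT] := independent_transversal h_sym h_irr deg_h _ _ disjY.
- by rewrite cardY.
case: (arg_minnP (fun t => #|missed t|) tT) => t0 t0T t0_min.
by exists t0; split; [apply/transversalP | apply: four_missed_le].
Qed.

End MissedCycles.

(** * The colouring of G - Z *)

Section Triangles.

Variables (T : finType) (h : rel T).
Hypothesis deg_h : max_deg_le h 2.

(** The other two vertices of [S] exhaust the degree bound at [x]. Hence distinct triangles are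
    disjoint. *)
Lemma triangle_eq (S : {set T}) x : S \in triangles h -> x \in S -> S = x |: nbhd h x.
Proof.
rewrite inE => /andP [/eqP S3 /forall_inP hS] xS; apply/eqP; rewrite eqEcard; apply/andP; split.
  apply/subsetP=> y yS; rewrite !inE; have [//= | nyx] := eqVneq y x.
  by have /forall_inP /(_ y yS) /implyP := hS x xS; apply; rewrite eq_sym.
by rewrite S3 cardsU1 -add1n leq_add ?leq_b1 // -[_ <= 2]/(deg h x <= 2).
Qed.

Lemma three_triangles_le : 3 * #|triangles h| <= #|T|.
Proof.
have triv : trivIset (triangles h).
  apply/trivIsetP => C D tC tD; apply: contraR => /pred0Pn [x /andP [/= xC xD]].
  by rewrite (triangle_eq tC xC) (triangle_eq tD xD).
rewrite mulnC -sum_nat_const; apply: leq_trans (max_card (mem (cover (triangles h)))).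
by rewrite -(eqP triv); apply: leq_sum => C; rewrite inE => /andP [/eqP ->].
Qed.

End Triangles.

(** * The fourth class, the deleted vertices and the other three colours *)

Section Assembly.

Variables (T : finType) (q : nat) (h : rel T) (Y : 'I_q -> {set T}).
Hypotheses (h_sym : symmetric h) (h_irr : irreflexive h) (deg_h : max_deg_le h 2).
Hypothesis cardY : forall j, #|Y j| = 4.
Hypothesis disjY : forall i j, i != j -> [disjoint Y i & Y j].
Variable t : {ffun 'I_q -> T}.
Hypothesis tT : transversal_on h Y setT t.

Let mem_class i j x : x \in Y i -> x \in Y j -> i = j.
Proof. exact: mem_part_inj. Qed.

Let t_in j : t j \in Y j.
Proof. by case: tT => tY _; apply: tY. Qed.

Let covered := \bigcup_j Y j.

(* One uncovered vertex in each missed cycle that is not covered. *)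
Definition loose_picks : {set T} :=
  [set x | [&& [forall y in component h x, deg h y == 2], [forall j, t j \notin component h x]
     & [pick y in component h x :\: \bigcup_j Y j] == Some x]].

Definition fourth : {set T} := t @: setT :|: loose_picks.

Definition deleted : {set T} :=
  [set x | (component h x \in missed h Y t) && ([pick y in component h x] == Some x)].

Lemma loose_picksP x : x \in loose_picks ->
  [/\ cycle_component h (component h x), forall j, t j \notin component h x & x \notin covered].
Proof.
rewrite inE => /and3P [/forall_inP deg2 /forallP noC].
case: pickP => // y; rewrite inE => /andP [ny _] /eqP [yx]; rewrite -yx in noC deg2 *.
by split=> //; split=> [|z /deg2 /eqP //]; exists y.
Qed.

Lemma loose_pick_unique x y : x \in loose_picks -> y \in loose_picks -> y \in component h x -> x = y.
Proof.
rewrite !inE => /and3P [_ _ /eqP px] /and3P [_ _ /eqP py] xy.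
by move: py; rewrite (component_mem h_sym (y := y) (x := x)) ?inE // px => -[].
Qed.

(** A loose pick lies on a cycle missed by [t], is the only pick on it, and belongs to no [Y j]; so
    neither [h] nor the gluing joins it to the class. *)
Lemma fourth_stable u v : u \in fourth -> v \in fourth -> ~~ glue h Y u v.
Proof.
have adj x y : x \in loose_picks -> y \in fourth -> ~~ h x y.
  move=> xL; have [cC noC _] := loose_picksP xL; apply/contraL => hxy.
  have yC : y \in component h x by rewrite inE connect1.
  rewrite inE negb_or; apply/andP; split.
    by apply: contraL yC => /imsetP [j _ ->].
  apply/negP => yL; move: hxy; rewrite -(loose_pick_unique xL yL yC).
  by rewrite h_irr.
move=> uS vS; rewrite /glue negb_or; apply/andP; split.
  case/setUP: (uS) => [/imsetP [i _ ui] | uL]; last exact: adj.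
  case/setUP: (vS) => [/imsetP [j _ vj] | vL]; last by rewrite h_sym adj.
  by case: tT => _ tI; rewrite ui vj tI.
rewrite negb_and; apply/norP => -[/negPn nuv /negPn /existsP [j /andP [uj vj]]].
have only x : x \in fourth -> x \in Y j -> x = t j.
  case/setUP => [/imsetP [i _ ->] ij | /loose_picksP [_ _ /bigcupP nx] xj].
    by rewrite (mem_class (t_in i) ij).
  by case: nx; exists j.
by move: nuv; rewrite (only u uS uj) (only v vS vj) eqxx.
Qed.

(** A cycle is hit by [t], or is missed and covered and loses a deleted vertex, or is missed and
    uncovered and gives up a loose pick. *)
Lemma cycle_meets C : cycle_component h C -> ~~ (C \subset ~: (fourth :|: deleted)).
Proof.
move=> cC; apply/subsetPn; have [x xC] : exists x, x \in C.
  by case: cC => -[x ->] _; exists x; rewrite inE.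
have compC y : y \in C -> component h y = C by move=> yC; rewrite -(cycle_eq_component h_sym cC yC).
have [noC | /forallPn [j /negPn tj]] := boolP [forall j, t j \notin C]; last first.
  by exists (t j) => //; rewrite !inE negbK imset_f.
have [gC | ngC] := boolP (C \subset covered).
  have Cm : C \in missed h Y t.
    by apply/mem_missed; split; [apply/covered_cycleP | apply/forallP].
  case pC: [pick y in C] => [y|]; last by move: pC; case: pickP => // /(_ x); rewrite /= xC.
  have yC : y \in C by move: pC; case: pickP => // z zC [<-].
  by exists y => //; rewrite in_setC negbK in_setU [y \in deleted]in_set (compC y yC) Cm pC eqxx orbT.
case pC: [pick y in C :\: covered] => [y|]; last first.
  by case/subsetPn: ngC => z zC nz; move: pC; case: pickP => // /(_ z); rewrite inE nz zC.
have yC : y \in C by move: pC; case: pickP => // z; rewrite inE => /andP [_ zC] [<-].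
exists y => //; rewrite in_setC negbK in_setU in_setU [y \in loose_picks]in_set (compC y yC).
rewrite pC eqxx noC; case: cC => _ deg2; rewrite andbT (_ : [forall y in C, _]) ?orbT //.
by apply/forall_inP => z /deg2 ->.
Qed.

Lemma deleted_unique x y : x \in deleted -> y \in deleted -> component h x = component h y -> x = y.
Proof.
rewrite in_set => /andP [_ /eqP px]; rewrite in_set => /andP [_ /eqP py] xy.
by move: px; rewrite xy py => -[].
Qed.

Lemma card_deleted : #|deleted| <= #|missed h Y t|.
Proof.
have comp_inj : {in deleted &, injective (component h)}.
  by move=> x y xZ yZ; apply: deleted_unique.
rewrite -(card_in_imset comp_inj); apply/subset_leq_card/subsetP=> _ /imsetP [x xZ ->].
by move: xZ; rewrite in_set => /andP [].
Qed.

(* Embeds the vertices outside [t] into the disjoint triangles; the vertices [t j]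
   get junk values. *)
Definition slot (v : T) : ('I_q + T) * 'I_3 :=
  if [pick j | v \in Y j] is Some j then (inl j, inord (index v (enum (Y j :\ t j))))
  else (inr v, ord0).

Lemma slot_class v j : v \in Y j -> slot v = (inl j, inord (index v (enum (Y j :\ t j)))).
Proof.
move=> vj; rewrite /slot; case: pickP => [i vi | /(_ j)]; last by rewrite vj.
by rewrite (mem_class vi vj).
Qed.

(** Removing [t j] leaves three vertices of [Y j], so the index is below 3 and [inord] preserves
    it. *)
Lemma slot_inj : {in [predC t @: setT] &, injective slot}.
Proof.
have not_t v j : v \notin t @: setT -> v != t j.
  by apply: contraNneq => ->; rewrite imset_f.
move=> u v; rewrite !inE => ut vt.
have [j uj | nu] := pickP (fun j => u \in Y j); last first.
  rewrite [slot u]/slot; case: pickP => [j | _]; first by rewrite nu.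
  by rewrite /slot; case: pickP => [//|_ [->]].
have [i vi | nv] := pickP (fun j => v \in Y j); last first.
  rewrite [slot v]/slot; case: pickP => [i | _]; first by rewrite nv.
  by rewrite (slot_class uj).
rewrite (slot_class uj) (slot_class vi) => -[ji]; rewrite -{i}ji in vi *.
have in_enum x : x \in Y j -> x \notin t @: setT -> x \in enum (Y j :\ t j).
  by move=> xj xt; rewrite mem_enum !inE xj not_t.
have lt3 x : x \in Y j -> x \notin t @: setT -> index x (enum (Y j :\ t j)) < 3.
  move=> xj xt; have := in_enum x xj xt; rewrite -index_mem -cardE.
  by have /eqP := cardsD1 (t j) (Y j); rewrite cardY t_in eqSS => /eqP <-.
move/(congr1 val); rewrite /= !inordK ?lt3 // => /(congr1 (nth u (enum (Y j :\ t j)))).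
by rewrite !nth_index ?in_enum.
Qed.

Lemma colouring_minus_deleted : colourable_minus (glue h Y) deleted 4.
Proof.
set W := ~: (fourth :|: deleted).
have [s [uniq_s sW edges]] := forest_listing h_sym h_irr deg_h
  (forest_without_cycles h_sym deg_h cycle_meets).
have W_notin v : v \in W -> v \notin t @: setT.
  by rewrite in_setC !in_setU !negb_or -andbA => /and3P [].
have slot_injW : {in W &, injective slot}.
  by move=> u v uW vW; apply: slot_inj; rewrite inE W_notin.
pose rest := [seq v <- enum {: ('I_q + T) * 'I_3} | v \notin map slot s].
have [||c c_inj c_path] := @path_triangles_colouring _ (map slot s ++ rest).
- rewrite cat_uniq map_inj_in_uniq ?uniq_s => [|u v]; last by rewrite !sW; apply: slot_injW.
  rewrite filter_uniq ?enum_uniq // andbT; apply/hasPn=> v.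
  by rewrite mem_filter => /andP [].
- by move=> v; rewrite mem_cat mem_filter mem_enum andbT orbN.
pose r := relpre slot (fun u v => c u != c v).
have r_path : sorted r s by have [] := cat_sorted2 c_path; rewrite sorted_map.
have r_sym : symmetric r by move=> u v; rewrite /r /= eq_sym.
exists (fun v => if v \in fourth then ord_max else lift ord_max (c (slot v))).
move=> u v uZ vZ guv; have inW x : x \notin fourth -> x \notin deleted -> x \in W.
  by move=> xS xZ; rewrite in_setC in_setU negb_or xS.
case: ifPn => uS; case: ifPn => vS; first by have := fourth_stable uS vS; rewrite guv.
- by rewrite neq_lift.
- by rewrite eq_sym neq_lift.
rewrite (inj_eq lift_inj); have uW := inW u uS uZ; have vW := inW v vS vZ.
case/orP: guv => [huv | /andP [nuv /existsP [j /andP [uj vj]]]].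
  (* Edges of [h] run along the path; glued pairs share a triangle, whose colours are distinct. *)
  exact: (edges r r_sym r_path u v uW vW huv).
apply: contra nuv => /eqP eq_c; apply/eqP/slot_injW => //.
by move: eq_c; rewrite (slot_class uj) (slot_class vj) => /c_inj ->.
Qed.

End Assembly.

Theorem theorem4p1 (T : finType) (h : rel T) (q : nat) (Y : 'I_q -> {set T}) :
  simple_graph h ->
  max_deg_le h 2 ->
  (forall j, #|Y j| = 4) ->
  (forall i j, i != j -> [disjoint Y i & Y j]) ->
  exists Z : {set T},
    [/\ 4 * #|Z| <= #|triangles h|,
        (forall C, cycle_component h C -> #|C :&: Z| <= 1),
        colourable_minus (glue h Y) Z 4
      & 12 * #|~: Z| >= 11 * #|T| ].
Proof.
move=> [h_sym h_irr] deg_h cardY disjY.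
have [t [tT few]] := transversal_few_missed h_sym h_irr deg_h cardY disjY.
have le_Z := leq_trans (leq_mul (leqnn 4) (card_deleted h Y t)) few.
exists (deleted h Y t); split=> //.
- move=> C cC; apply/card_le1_eqP => x y; rewrite 2!in_setI => /andP [xC xZ] /andP [yC yZ].
  apply: deleted_unique yZ xZ _.
  by rewrite -(cycle_eq_component h_sym cC xC) -(cycle_eq_component h_sym cC yC).
- exact: colouring_minus_deleted.
(* Since 4 |Z| is at most the number of triangles, and these are disjoint, 12 |Z| <= |V|. *)
- have := three_triangles_le deg_h; have := cardsC (deleted h Y t); lia.
Qed.
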